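(* Let $0<\alpha\le 1$ and let $f\in C^{1,\alpha}(\mathbb{R}^n)$. If $f$ is non-negative then $\sqrt f\in C^{\frac{1+\alpha}{2}}(\mathbb{R}^n)$.
   Context: For $0<\alpha\le1$, $C^{1,\alpha}(\mathbb{R}^n)$ is the set of continuously differentiable real-valued functions $f$ on $\mathbb{R}^n$ whose first-order partial derivatives $h=\partial_i f$ all satisfy $\sup_{x\ne y}\frac{|h(x)-h(y)|}{|x-y|^\alpha}<\infty$. For $0<\gamma\le 1$, here $C^{\gamma}(\mathbb{R}^n)$ is the set of real-valued functions $g$ on $\mathbb{R}^n$ with $\sup_{x\neq y}\frac{|g(x)-g(y)|}{|x-y|^\gamma}<\infty$; in particular when $\alpha=1$ the space $C^{\frac{1+\alpha}{2}}(\mathbb{R}^n)$ is the space of Lipschitz functions. *)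

(* Defs.v *)
From mathcomp Require Import all_boot all_order all_algebra.
From mathcomp Require Import all_classical all_reals all_analysis.

Set Implicit Arguments.
Unset Strict Implicit.
Unset Printing Implicit Defensive.

Import Order.TTheory GRing.Theory Num.Theory.
Import numFieldNormedType.Exports.

Local Open Scope classical_set_scope.
Local Open Scope ring_scope.

(* The canonical norm on ['rV[R]_n] is the sup norm. Both norms induce the
   same topology, so continuity and directional derivatives are unaffected. *)
Definition euclidean_norm (R : realType) (n : nat) (x : 'rV[R]_n) : R :=
  Num.sqrt (\sum_(i < n) x ord0 i ^+ 2).

(* [a `^ g] is the real power. The supremum is taken in [\bar R], hence it is
   [-oo] when n = 0, where there are no two distinct points. *)
Definition holder_quotient_sup (R : realType) (n : nat) (g : R)
    (h : 'rV[R]_n -> R) : \bar R :=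
  ereal_sup [set q : \bar R | exists x y : 'rV[R]_n, x <> y /\
    q = (`|h x - h y| / euclidean_norm (x - y) `^ g)%:E].

Definition holder (R : realType) (n : nat) (g : R) (h : 'rV[R]_n -> R) : Prop :=
  (holder_quotient_sup g h < +oo)%E.

Definition partial (R : realType) (n : nat) (i : 'I_n) (f : 'rV[R]_n -> R) :
    'rV[R]_n -> R :=
  fun x => 'D_(delta_mx ord0 i) f x.

(* ['D_v f x] is total, so existence of the partial derivatives is required
   separately. *)
Definition continuously_differentiable (R : realType) (n : nat)
    (f : 'rV[R]_n -> R) : Prop :=
  forall i : 'I_n,
    (forall x : 'rV[R]_n, derivable f x (delta_mx ord0 i)) /\
    continuous (partial i f).

Definition C1holder (R : realType) (n : nat) (a : R) (f : 'rV[R]_n -> R) : Prop :=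
  continuously_differentiable f /\ forall i : 'I_n, holder a (partial i f).

(* Main.v *)
(* It suffices to bound the increments of sqrt f along coordinate directions,
   since moving from x to y one coordinate at a time then costs n such bounds.
   On a coordinate line g = f(x + t e_i) is nonnegative and satisfies
   |g(s) - g(t) - g'(t)(s - t)| <= K |s - t|^(1+a). Positivity of g at t +- eta
   gives |g'(t)| eta <= g(t) + K eta^(1+a). With h = |s - t| and g(t) <= g(s):
   if g(t) <= h^(1+a), take eta = h, so that g(s) is O(h^(1+a)); otherwise take
   eta = g(t)^(1/(1+a)) > h, so that |g'(t)| is O(g(t)^(a/(1+a))), and divide the
   increment of g by sqrt (g(t)). *)

Require Import Defs.
From mathcomp Require Import all_boot all_order all_algebra.
From mathcomp Require Import all_classical all_reals all_analysis.
From mathcomp Require Import ring lra.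

Import Order.TTheory GRing.Theory Num.Theory.
Import numFieldNormedType.Exports.

Local Open Scope ring_scope.

Lemma euclidean_norm_ge_coord (R : realType) (n : nat) (x : 'rV[R]_n) (i : 'I_n) :
  `|x ord0 i| <= euclidean_norm x.
Proof.
rewrite -sqrtr_sqr ler_sqrt; last by apply: sumr_ge0 => j _; exact: sqr_ge0.
by rewrite (bigD1 i) //= lerDl; apply: sumr_ge0 => j _; exact: sqr_ge0.
Qed.

Lemma euclidean_norm_gt0 (R : realType) (n : nat) (x : 'rV[R]_n) :
  x <> 0 -> 0 < euclidean_norm x.
Proof.
move=> x0; rewrite lt_neqAle sqrtr_ge0 andbT; apply/eqP => nx0; apply: x0.
apply/rowP => i; apply/eqP; rewrite mxE -normr_eq0.
by rewrite eq_le normr_ge0 andbT nx0 euclidean_norm_ge_coord.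
Qed.

Lemma euclidean_norm_delta (R : realType) (n : nat) (i : 'I_n) (t : R) :
  euclidean_norm (t *: delta_mx ord0 i : 'rV[R]_n) = `|t|.
Proof.
rewrite /euclidean_norm (bigD1 i) //= big1 => [|j ji]; last first.
  by rewrite !mxE (negbTE ji) andbF mulr0 expr0n.
by rewrite !mxE !eqxx mulr1 addr0 sqrtr_sqr.
Qed.

Lemma holderP (R : realType) (n : nat) (g : R) (h : 'rV[R]_n -> R) :
  holder g h <-> exists2 K : R, 0 <= K &
    forall x y, `|h x - h y| <= K * euclidean_norm (x - y) `^ g.
Proof.
split=> [hg|[K K0 hK]]; last first.
  apply: (@le_lt_trans _ _ K%:E); last exact: ltry.
  apply: ge_ereal_sup => _ [x [y [xy ->]]]; rewrite lee_fin.
  rewrite ler_pdivrMr ?hK// powR_gt0// euclidean_norm_gt0// => /subr0_eq.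
  exact: xy.
(* The maximum with 0 replaces the value [-oo], taken when no two points are distinct, and makes the
   constant nonnegative. *)
exists (fine (maxe 0 (holder_quotient_sup g h)))%E.
  by rewrite fine_ge0// le_max lexx.
move=> x y; have [->|/eqP xy] := eqVneq x y.
  by rewrite subrr normr0 mulr_ge0 ?powR_ge0// fine_ge0// le_max lexx.
rewrite -ler_pdivrMr; last first.
  by rewrite powR_gt0// euclidean_norm_gt0// => /subr0_eq.
rewrite -lee_fin fineK.
  rewrite le_max; apply/orP; right; apply: ereal_sup_ubound.
  by exists x, y.
by rewrite ge0_fin_numE ?le_max ?lexx// gt_max ltry.
Qed.

(** Both derivatives are limits of the same difference quotient. *)
Lemma is_derive_slice (R : realType) (n : nat) (i : 'I_n) (f : 'rV[R]_n -> R)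
    (x : 'rV[R]_n) (t : R) :
  derivable f (x + t *: delta_mx ord0 i) (delta_mx ord0 i) ->
  is_derive t 1 (fun u : R => f (x + u *: delta_mx ord0 i))
    (partial i f (x + t *: delta_mx ord0 i)).
Proof.
set e := delta_mx _ _ => df.
have quotientE : (fun h : R => h^-1 *: (((fun u : R => f (x + u *: e)) \o shift t)
      (h *: (1 : R)) - f (x + t *: e))) =
    (fun h : R => h^-1 *: ((f \o shift (x + t *: e)) (h *: e) - f (x + t *: e))).
  apply/funext => h /=; congr (_ *: (f _ - _)).
  by rewrite /shift /= [h *: 1]mulr1 scalerDl addrCA.
by apply: DeriveDef; rewrite /derivable /partial /derive quotientE.
Qed.

(** The order of [t] and [s] is left open because the Taylor estimate is applied on both sides of
    [t]. *)
Lemma mean_value (R : realType) (g dg : R -> R) (t s : R) :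
  (forall u : R, is_derive u 1 g (dg u)) ->
  exists2 c, `|c - t| <= `|s - t| & g s - g t = dg c * (s - t).
Proof.
move=> gD.
have seg (a b : R) : a <= b ->
    exists2 c, a <= c <= b & g b - g a = dg c * (b - a).
  move=> ab; have [|c] := @MVT_segment R g dg a b ab (fun u _ => gD u).
    by apply: derivable_within_continuous => u _; case: (gD u).
  by rewrite in_itv /= => ? ?; exists c.
have [ts|/ltW st] := leP t s.
  have [c /andP[tc cs] cE] := seg _ _ ts.
  by exists c => //; rewrite !ger0_norm ?subr_ge0// lerB.
have [c /andP[sc ct] cE] := seg _ _ st.
exists c; first by rewrite !ler0_norm ?subr_le0// lerN2 lerB.
by rewrite -opprB cE -mulrN opprB.
Qed.

Lemma sqr_powR_half (R : realType) (a h : R) : 0 < h ->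
  (h `^ ((1 + a) / 2)) ^+ 2 = h `^ a * h.
Proof.
move=> h0; rewrite expr2 -powRD; last by rewrite (gt_eqF h0) implybT.
have -> : (1 + a) / 2 + (1 + a) / 2 = a + 1 by field.
by rewrite powRD ?(gt_eqF h0) ?implybT// powRr1// ltW.
Qed.

Section nonnegative_C1holder.
Variables (R : realType) (a K : R) (g dg : R -> R).
Hypotheses (a_gt0 : 0 < a) (a_le1 : a <= 1) (K_ge0 : 0 <= K).
Hypothesis gD : forall u : R, is_derive u 1 g (dg u).
Hypothesis dgK : forall u v, `|dg u - dg v| <= K * `|u - v| `^ a.
Hypothesis g_ge0 : forall u, 0 <= g u.

(** The mean value point lies within [|s - t|] of [t], so replacing its derivative by [dg t] costs
    at most [K * |s - t| ^ a]. *)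
Lemma taylor_le (t s : R) :
  g s <= g t + dg t * (s - t) + K * (`|s - t| `^ a * `|s - t|).
Proof.
have [c cts gE] := mean_value R g dg t s gD.
have -> : g s = g t + dg t * (s - t) + (dg c - dg t) * (s - t).
  by rewrite -(subrK (g t) (g s)) gE; ring.
rewrite lerD2l (le_trans (ler_norm _))// normrM mulrA ler_wpM2r//.
rewrite (le_trans (dgK _ _))// ler_wpM2l// ge0_ler_powR ?nnegrE// ltW//.
Qed.

(* Nonnegativity of the Taylor majorant at the points t + eta and t - eta. *)
Lemma derivative_le (t eta : R) : 0 < eta ->
  `|dg t| * eta <= g t + K * (eta `^ a * eta).
Proof.
move=> eta0.
have := le_trans (g_ge0 _) (taylor_le t (t + eta)).
have := le_trans (g_ge0 _) (taylor_le t (t - eta)).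
rewrite -!(addrAC t (- t)) subrr !add0r !normrN !(gtr0_norm eta0).
by have [?|?] := ger0P (dg t); lra.
Qed.

(** A one-sided bound suffices, as [t] and [s] can be exchanged. *)
Lemma sqrt_increment_le (t s : R) : t != s ->
  Num.sqrt (g s) <=
  Num.sqrt (g t) + (1 + 2 * K) * `|s - t| `^ ((1 + a) / 2).
Proof.
move: a_le1 K_ge0 => a1 K0.
rewrite eq_sym -subr_eq0 -normr_gt0; set h := `|s - t| => h0.
set gam := (1 + a) / 2; have gam0 : 0 < gam by rewrite divr_gt0// addr_gt0.
set p := Num.sqrt (g t); set q := Num.sqrt (g s); set H := h `^ gam.
have p0 : 0 <= p by exact: sqrtr_ge0.
have H0 : 0 < H by exact: powR_gt0.
have pE : g t = p ^+ 2 by rewrite sqr_sqrtr.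
have qE : g s = q ^+ 2 by rewrite sqr_sqrtr.
have HE : h `^ a * h = H ^+ 2 by rewrite sqr_powR_half.
have KH0 : 0 <= K * H by rewrite mulr_ge0// ltW.
have KH20 : 0 <= K * H ^+ 2 by rewrite mulr_ge0// sqr_ge0.
have Kp0 : 0 <= K * H * p by rewrite mulr_ge0.
have pH0 : 0 <= H * p by rewrite mulr_ge0// ltW.
have KKH0 : 0 <= (K * H) ^+ 2 by exact: sqr_ge0.
have q2 : q ^+ 2 <= p ^+ 2 + `|dg t| * h + K * H ^+ 2.
  rewrite -qE -pE -HE (le_trans (taylor_le t s))// lerD2r lerD2l.
  by rewrite (le_trans (ler_norm _))// normrM.
have rhs0 : 0 <= p + (1 + 2 * K) * H.
  by rewrite addr_ge0// mulr_ge0 ?(ltW H0)//; lra.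
suff : q ^+ 2 <= (p + (1 + 2 * K) * H) ^+ 2.
  by rewrite ler_pXn2r ?nnegrE// sqrtr_ge0.
apply: (le_trans q2); have [pH|Hp] := leP p H.
  (* Here [q^2 <= 2 p^2 + 2 K H^2 <= p^2 + (1 + 2 K) H^2], and [1 + 2 K <= (1 + 2 K)^2]. *)
  have := derivative_le t h h0; rewrite pE HE => dh.
  have : p ^+ 2 <= H ^+ 2 by rewrite ler_pXn2r ?nnegrE// ltW.
  nra.
(* When sqrt (g t) dominates, compare g at the scale eta with
   eta `^ (1 + a) = g t, which is the optimal one in [derivative_le]. *)
have p_gt0 : 0 < p by exact: lt_trans Hp.
pose eta := p `^ gam^-1.
have eta0 : 0 < eta by exact: powR_gt0.
have etaE : eta `^ gam = p by rewrite -powRrM mulVf ?gt_eqF// powRr1.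
have h_le_eta : h <= eta.
  rewrite leNgt; apply/negP => /ltW le_eta.
  have := ge0_ler_powR (ltW gam0) (ltW eta0 : eta \is Num.nneg)
    (ltW h0 : h \is Num.nneg) le_eta.
  by rewrite etaE leNgt Hp.
(* Since [eta ^ a * eta = p^2 = g t], the bound on [|dg t| * eta] is [(1 + K) * eta ^ a * eta];
   cancel [eta]. *)
have d_le : `|dg t| <= (1 + K) * eta `^ a.
  rewrite -(ler_pM2r eta0) (le_trans (derivative_le t eta eta0))//.
  by rewrite -mulrA -sqr_powR_half// etaE pE; lra.
(* The exponents match because [a + (1 - gam) = gam]; then [h <= eta] and [gam <= 1] conclude. *)
have eta_h : eta `^ a * h <= H * p.
  have -> : h = H * h `^ (1 - gam).
    rewrite -powRD ?(gt_eqF h0) ?implybT//.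
    by rewrite addrC subrK powRr1// ltW.
  rewrite mulrCA ler_wpM2l ?(ltW H0)// -etaE.
  have -> : eta `^ gam = eta `^ a * eta `^ (1 - gam).
    rewrite -powRD ?(gt_eqF eta0) ?implybT//; congr (_ `^ _).
    by rewrite /gam; field.
  rewrite ler_wpM2l ?powR_ge0// ge0_ler_powR ?nnegrE ?(ltW h0) ?(ltW eta0)//.
  by rewrite /gam; lra.
have : `|dg t| * h <= (1 + K) * (H * p).
  apply: (@le_trans _ _ ((1 + K) * eta `^ a * h)).
    by rewrite ler_wpM2r// ltW.
  by rewrite -mulrA ler_wpM2l//; lra.
(* Thus [q^2 <= p^2 + (1 + K) H p + K H^2 <= p^2 + (1 + 2 K) H p], which the square on the right
   dominates. *)
have : H ^+ 2 <= H * p by rewrite expr2 ler_wpM2l// ltW.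
nra.
Qed.

Lemma sqrt_holder_1d (t s : R) :
  `|Num.sqrt (g s) - Num.sqrt (g t)| <=
  (1 + 2 * K) * `|s - t| `^ ((1 + a) / 2).
Proof.
move: K_ge0 => K0; have [->|ts] := eqVneq t s.
  by rewrite subrr normr0 mulr_ge0 ?powR_ge0//; lra.
have := sqrt_increment_le t s ts.
have := sqrt_increment_le s t; rewrite eq_sym ts distrC => /(_ isT).
by rewrite ler_norml => ? ?; apply/andP; split; lra.
Qed.

End nonnegative_C1holder.

Lemma coordinatewise_holder (R : realType) (n : nat) (b C : R)
    (u : 'rV[R]_n -> R) : 0 <= b -> 0 <= C ->
  (forall (i : 'I_n) x t,
     `|u (x + t *: delta_mx ord0 i) - u x| <= C * `|t| `^ b) ->
  holder b u.
Proof.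
move=> b0 C0 uC; apply/holderP; exists (C *+ n); first exact: mulrn_wge0.
move=> x y.
(* z k interpolates between x and y, one coordinate at a time. *)
pose z k : 'rV[R]_n := \row_i (if (i < k)%N then x ord0 i else y ord0 i).
have zn : z n = x by apply/rowP => i; rewrite mxE ltn_ord.
have z0 : z 0%N = y by apply/rowP => i; rewrite mxE.
have zS (i : 'I_n) : z i.+1 = z i + (x - y) ord0 i *: delta_mx ord0 i.
  apply/rowP => j; rewrite !mxE eqxx /= ltnS.
  rewrite leq_eqVlt val_eqE; have [->|ji] := eqVneq j i.
    by rewrite ltnn /= mulr1 addrC subrK.
  by rewrite mulr0 addr0.
(* The increment of [u] telescopes along [z]; each step moves one coordinate by at most the
   Euclidean norm of [x - y]. *)
rewrite -zn -[in u y]z0 -(telescope_sumr (u \o z) (leq0n n)) big_mkord.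
rewrite zn (le_trans (ler_norm_sum _ _ _))//.
rewrite mulrnAl -[X in _ *+ X]card_ord -sumr_const; apply: ler_sum => i _ /=.
rewrite zS (le_trans (uC _ _ _))// ler_wpM2l// ge0_ler_powR ?nnegrE//.
  exact: sqrtr_ge0.
exact: euclidean_norm_ge_coord.
Qed.

Theorem corollary2p18 (R : realType) (n : nat) (a : R) (f : 'rV[R]_n -> R)
    (a_gt0 : 0 < a) (a_le1 : a <= 1) (fC : C1holder a f)
    (f_ge0 : forall x : 'rV[R]_n, 0 <= f x) :
  holder ((1 + a) / 2) (fun x : 'rV[R]_n => Num.sqrt (f x)).
Proof.
case: fC => fD fH.
have /choice[K KP] (i : 'I_n) : exists K : R, 0 <= K /\ forall x y,
    `|partial i f x - partial i f y| <= K * euclidean_norm (x - y) `^ a.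
  by have /holderP[K K0 KP] := fH i; exists K.
(* The sum dominates every [K i], so one constant serves all directions. *)
pose M := \sum_i K i.
have M0 : 0 <= M by apply: sumr_ge0 => i _; case: (KP i).
apply: (@coordinatewise_holder _ _ _ (1 + 2 * M)); [lra|lra|] => i x t.
pose e : 'rV[R]_n := delta_mx ord0 i.
have slice := @sqrt_holder_1d R a M (fun s => f (x + s *: e))
  (fun s => partial i f (x + s *: e)) a_gt0 a_le1 M0.
have {slice} := slice _ _ _ 0 t; rewrite scale0r addr0 subr0; apply.
- by move=> s; apply: is_derive_slice; case: (fD i).
- move=> s r; have [_ /(_ (x + s *: e) (x + r *: e)) /le_trans] := KP i; apply.
  have -> : x + s *: e - (x + r *: e) = (s - r) *: e.
    by rewrite opprD addrACA subrr add0r scalerBl.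
  rewrite euclidean_norm_delta ler_wpM2r ?powR_ge0//.
  by rewrite /M (bigD1 i)//= lerDl; apply: sumr_ge0 => j _; case: (KP j).
- by move=> s.
Qed.
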